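(* Let $\kappa$ be an infinite cardinal, let $X$ be a Banach space admitting a boundary with property $(\star)$, and let $0\to c_0(\kappa)\to Z\to X\to 0$ be an exact sequence of Banach spaces. Then $Z$ admits, under an equivalent renorming, a boundary with property $(\star)$. In particular, $Z$ is isomorphically polyhedral.
   Context: An exact sequence of Banach spaces is a diagram $0\to Y\to Z\to X\to 0$ of Banach spaces and bounded linear operators in which the kernel of each operator equals the image of the preceding one; $Z$ is called a twisted sum of $Y$ and $X$. Given a Banach space $X$ with dual unit sphere $S_{X^*}$, a subset $B\subseteq S_{X^*}$ is a boundary if for every $x\in X$ there is $x^*\in B$ with $\langle x^*,x\rangle=\|x\|$. A boundary $B$ has property $(\star)$ if for every weak*-cluster point $x^*$ of $B$ (a point each of whose weak* neighbourhoods contains infinitely many elements of $B$) one has $x^*(x)<1$ whenever $\|x\|=1$. A Banach space is polyhedral if each of its finite-dimensional subspaces is isometric to a subspace of $\ell_\infty^n$ for some $n\in\mathbb N$ (equivalently, has a polytope as unit ball); it is isomorphically polyhedral if it is linearly isomorphic to a polyhedral space. *)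

(* Defs.v *)
From HB Require Import structures.
From mathcomp Require Import all_boot all_order all_algebra.
From mathcomp Require Import all_classical all_reals all_analysis.

Set Implicit Arguments.
Unset Strict Implicit.
Unset Printing Implicit Defensive.

Import Order.TTheory GRing.Theory Num.Theory.
Import numFieldNormedType.Exports.

Local Open Scope classical_set_scope.
Local Open Scope ring_scope.

Section C0.
Context (R : realType) (K : Type).

Definition vanishing : {pred K -> R} :=
  [pred f | `[< forall e : R, 0 < e -> finite_set [set k | e <= `|f k|] >]].

Record c0 := C0 { c0_fun :> K -> R; _ : c0_fun \in vanishing }.

HB.instance Definition _ := [isSub for c0_fun].
HB.instance Definition _ := [Choice of c0 by <:].

Lemma vanishingP (f : K -> R) :
  reflect (forall e : R, 0 < e -> finite_set [set k | e <= `|f k|])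
          (f \in vanishing).
Proof. exact: asboolP. Qed.

Lemma vanishing_submod_closed : submod_closed vanishing.
Proof.
split.
  apply/vanishingP => e e0; apply: (sub_finite_set _ (finite_set0 K)) => k /=.
  by rewrite normr0 leNgt e0.
move=> a f g /vanishingP fv /vanishingP gv; apply/vanishingP => e e0.
have a0 : 0 < `|a| + 1 by rewrite ltr_wpDl.
have d0 : 0 < e / 2 / (`|a| + 1) by rewrite !divr_gt0.
have e2 : 0 < e / 2 by rewrite divr_gt0.
have : finite_set ([set k | e / 2 / (`|a| + 1) <= `|f k|] `|`
                   [set k | e / 2 <= `|g k|]).
  by rewrite finite_setU; split; [exact: fv|exact: gv].
apply: sub_finite_set => k /= ek; apply/orP; rewrite -implyNb -ltNge.
apply/implyP => fk; rewrite leNgt; apply/negP => gk; move: ek; apply/negP.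
rewrite -ltNge (le_lt_trans (ler_normD _ _))// [ltRHS](splitr e).
rewrite (_ : (a *: f) k = a * f k)// normrM ler_ltD// .
rewrite (le_trans (ler_wpM2l _ (ltW fk)))// mulrCA ger_pMr// ler_pdivrMr//.
by rewrite mul1r lerDl.
Qed.

HB.instance Definition _ := GRing.isSubmodClosed.Build _ _ vanishing
  vanishing_submod_closed.
HB.instance Definition _ := [SubChoice_isSubLmodule of c0 by <:].

Definition c0_norm (f : c0) : R := sup [set `|f k| | k in [set: K]].

Lemma c0_norm_ub (f : c0) k : `|f k| <= c0_norm f.
Proof.
apply: ub_le_sup; last by exists k.
have /vanishingP/(_ 1 ltr01) : c0_fun f \in vanishing by case: f.
move=> /(finite_image (fun k => `|f k|))/finite_seqP[s sE].
exists (\big[Num.max/1]_(x <- s) x) => _ [j _ <-].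
have [fj|fj] := leP 1 `|f j|; last first.
  by rewrite (le_trans (ltW fj))// bigmax_ge_id.
suff js : `|f j| \in s by apply: le_bigmax_seq js _.
have : [set` s] `|f j| by rewrite -sE; exists j.
by [].
Qed.

Lemma c0_norm_le (f : c0) (M : R) :
  0 <= M -> (forall k, `|f k| <= M) -> c0_norm f <= M.
Proof.
move=> M0 fM; rewrite /c0_norm.
have [->|ne] := eqVneq [set `|f k| | k in [set: K]] set0; first by rewrite sup0.
by apply: ge_sup => [|_ [k _ <-]]; [exact/set0P|exact: fM].
Qed.

Lemma c0_norm_ge0 (f : c0) : 0 <= c0_norm f.
Proof.
rewrite /c0_norm.
have [->|/set0P[_ [k _ _]]] := eqVneq [set `|f k| | k in [set: K]] set0.
  by rewrite sup0.
exact: le_trans (normr_ge0 _) (c0_norm_ub f k).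
Qed.

Lemma c0D (f g : c0) k : (f + g) k = f k + g k. Proof. by []. Qed.
Lemma c0B (f g : c0) k : (f - g) k = f k - g k. Proof. by []. Qed.
Lemma c0Z a (f : c0) k : (a *: f) k = a * f k. Proof. by []. Qed.

Lemma c0_normD (f g : c0) : c0_norm (f + g) <= c0_norm f + c0_norm g.
Proof.
apply: c0_norm_le => [|k]; first by rewrite addr_ge0// c0_norm_ge0.
by rewrite c0D (le_trans (ler_normD _ _))// lerD// c0_norm_ub.
Qed.

Lemma c0_normZ (a : R) (f : c0) : c0_norm (a *: f) = `|a| * c0_norm f.
Proof.
have le b g : c0_norm (b *: g) <= `|b| * c0_norm g.
  apply: c0_norm_le => [|k]; first by rewrite mulr_ge0// c0_norm_ge0.
  by rewrite c0Z normrM ler_wpM2l// c0_norm_ub.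
apply/eqP; rewrite eq_le le/=.
have [->|a0] := eqVneq a 0; first by rewrite normr0 mul0r c0_norm_ge0.
rewrite -ler_pdivlMl ?normr_gt0// -normfV.
by rewrite -{1}[f]scale1r -(mulVf a0) -scalerA.
Qed.

Lemma c0_norm_eq0 (f : c0) : c0_norm f = 0 -> f = 0.
Proof.
move=> f0; apply/val_inj/funext => k; apply/eqP.
by rewrite -normr_le0 -f0 c0_norm_ub.
Qed.

HB.instance Definition _ := Lmodule_isNormed.Build R c0
  c0_normD c0_normZ c0_norm_eq0.

Lemma c0_complete (F : set_system c0) : ProperFilter F -> cauchy F -> cvg F.
Proof.
move=> FF /cauchy_ballP Fc.
have Fk (k : K) : cvg ((fun f : c0 => f k) @ F).
  apply: R_complete; apply/cauchy_ballP => e e0.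
  rewrite near_map2; apply: filterS (Fc e e0) => -[f g].
  rewrite -!ball_normE/=; apply: le_lt_trans.
  by rewrite -c0B; exact: c0_norm_ub.
pose l k : R := lim ((fun f : c0 => f k) @ F).
have Fl (e : R) : 0 < e -> \forall f \near F, forall k, `|l k - (f : c0) k| <= e.
  move=> e0; have e2 : 0 < e / 2 by rewrite divr_gt0.
  near=> f => k; near F => g.
  have lg : `|l k - g k| < e / 2.
    by near: g; move/cvgrPdist_lt: (Fk k) => /(_ _ e2).
  have fg : `|f - g| < e / 2.
    have : ball f (e / 2) g.
      by near: g; near: f; apply: nearP_dep; exact: Fc.
    by rewrite -ball_normE.
  rewrite (splitr e) -(subrK (g k) (l k)) -addrA.
  rewrite (le_trans (ler_normD _ _))// lerD//; first exact: ltW.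
  rewrite distrC -c0B (le_trans (c0_norm_ub _ _))//; exact: ltW.
have lv : l \in vanishing.
  apply/vanishingP => e e0; have e2 : 0 < e / 2 by rewrite divr_gt0.
  have [f lf] : exists f : c0, forall k, `|l k - f k| <= e / 2.
    by near F => f; exists f; near: f; exact: Fl.
  have /vanishingP/(_ _ e2) : c0_fun f \in vanishing by case: (f).
  apply: sub_finite_set => k /= elk.
  rewrite -(lerD2l (e / 2)) -splitr (le_trans elk)//.
  by rewrite -{1}(subrK (f k) (l k)) (le_trans (ler_normD _ _))// lerD2r.
apply/cvg_ex; exists (C0 lv); apply/cvgrPdist_le => e e0.
by apply: filterS (Fl e e0) => f lf; apply: c0_norm_le; [exact: ltW|exact: lf].
Unshelve. all: by end_near. Qed.

HB.instance Definition _ := Uniform_isComplete.Build c0 c0_complete.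

End C0.

Definition short_exact (R : realType) (Y Z X : completeNormedModType R)
    (i : {linear Y -> Z}) (q : {linear Z -> X}) : Prop :=
  [/\ continuous i, continuous q,
      i @^-1` [set 0] = [set 0],
      q @^-1` [set 0] = range i
    & range q = setT].

Section Dual.
Context (R : realType) (X : normedModType R).

Record dual := Dual {
  dual_fun :> {linear X -> R^o};
  dual_continuous : continuous dual_fun
}.

HB.instance Definition _ := gen_eqMixin dual.
HB.instance Definition _ := gen_choiceMixin dual.

Definition dual_norm (f : dual) : R :=
  sup [set `|f x| | x in [set x : X | `|x| <= 1]].

Definition dual_sphere : set dual := [set f | dual_norm f = 1].

(* The weak* topology is that of pointwise convergence on X. *)
Definition weak_star : Type :=
  initial_topology (fun f : dual => (f : X -> R^o) : {ptws X -> R^o}).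

HB.instance Definition _ := Topological.on weak_star.

Definition weak_star_cluster (B : set dual) (f : dual) : Prop :=
  forall U : set dual, nbhs (f : weak_star) U -> infinite_set (B `&` U).

Definition boundary (B : set dual) : Prop :=
  B `<=` dual_sphere /\ forall x : X, exists2 f : dual, B f & f x = `|x|.

Definition property_star (B : set dual) : Prop :=
  forall f : dual, weak_star_cluster B f ->
  forall x : X, `|x| = 1 -> (f x : R) < 1.

Definition has_star_boundary : Prop :=
  exists B : set dual, boundary B /\ property_star B.

End Dual.

Section Renorming.
Context (R : realType).

Record equiv_norm (V : normedModType R) := EquivNorm {
  enorm :> V -> R;
  enormD : forall x y, enorm (x + y) <= enorm x + enorm y;
  enormZ : forall (a : R) x, enorm (a *: x) = `|a| * enorm x;
  enorm_eq0 : forall x, enorm x = 0 -> x = 0;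
  enorm_equiv : exists2 C : R, 0 < C &
    forall x, enorm x <= C * `|x| /\ `|x| <= C * enorm x
}.

Definition renormed (V : normedModType R) (N : equiv_norm V) : Type := V.

Section NormedModule.
Context (V : normedModType R) (N : equiv_norm V).
HB.instance Definition _ := GRing.Lmodule.copy (renormed N) V.
HB.instance Definition _ := Lmodule_isNormed.Build R (renormed N)
  (@enormD _ N) (@enormZ _ N) (@enorm_eq0 _ N).
End NormedModule.

Section Complete.
Context (V : completeNormedModType R) (N : equiv_norm V).

Lemma renormed_complete (F : set_system (renormed N)) :
  ProperFilter F -> cauchy F -> cvg F.
Proof.
move=> FF /cauchy_ballP Fc.
have [C C0 NC] := enorm_equiv N.
pose G : set_system V := F; have GG : ProperFilter G by exact: FF.
have Fc' : cauchy G.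
  apply/cauchy_ballP => e e0.
  have := Fc (e / C) (divr_gt0 e0 C0); apply: filterS => -[x y].
  rewrite -!ball_normE/= => xy.
  by rewrite (le_lt_trans (NC _).2)// -ltr_pdivlMl// mulrC.
have Gl : G --> lim G := @cauchy_cvg V G GG Fc'.
apply/cvg_ex; exists (lim G : renormed N); apply/cvgrPdist_lt => e e0.
move/cvgrPdist_lt : Gl => /(_ _ (divr_gt0 e0 C0)); apply: filterS => x lx.
by rewrite (le_lt_trans (NC _).1)// -ltr_pdivlMl// mulrC.
Qed.

HB.instance Definition _ := Uniform_isComplete.Build (renormed N)
  renormed_complete.
End Complete.

End Renorming.

Section Polyhedral.
Context (R : realType).

Definition fin_dim_subspace (V : lmodType R) (F : set V) : Prop :=
  exists (m : nat) (e : 'I_m -> V),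
    F = [set \sum_(j < m) a j *: e j | a in [set: 'I_m -> R]].

(* The library norm on row vectors is the maximum norm, so 'rV[R]_n is
   l_infty^n. *)
Definition polyhedral (V : normedModType R) : Prop :=
  forall F : set V, fin_dim_subspace F ->
  exists (n : nat) (T : V -> 'rV[R]_n),
    (forall (a : R) (x y : V), F x -> F y -> T (a *: x + y) = a *: T x + T y) /\
    (forall x : V, F x -> `|T x| = `|x|).

Definition isomorphic (V W : normedModType R) : Prop :=
  exists (T : {linear V -> W}) (S : {linear W -> V}),
    [/\ cancel T S, cancel S T, continuous T & continuous S].

Definition isomorphically_polyhedral (V : normedModType R) : Prop :=
  exists P : completeNormedModType R, polyhedral P /\ isomorphic V P.

End Polyhedral.

(* Main.v *)
From HB Require Import structures.
Require Import Defs.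
From mathcomp Require Import all_boot all_order all_algebra.
From mathcomp Require Import all_classical all_reals all_analysis.
From mathcomp Require Import finmap ring lra.

Set Implicit Arguments.
Unset Strict Implicit.
Unset Printing Implicit Defensive.

Import Order.TTheory GRing.Theory Num.Theory.
Import numFieldNormedType.Exports.
Local Open Scope classical_set_scope.
Local Open Scope ring_scope.

(** Write phi_k for a Hahn-Banach extension to Z of the k-th coordinate
functional of c_0(K), seen on the subspace i(c_0(K)) = ker q of Z; the
extensions can be taken with a common bound M.  By the open mapping theorem
every x in X lifts to some w in Z with q w = x and |w| <= C |x|, so each z in Z
is w + i f with |phi_k w| <= M C |q z|.  As phi_k z = phi_k w + f_k and f tends
to 0, only finitely many coordinates of z exceed M C |q z| by a given amount.

Renorm Z by N z = max (2 M C |q z|, sup_k |phi_k z|).  The factor 2 separates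
the two terms: if the second one is larger, then it exceeds M C |q z|, so the
supremum is a maximum.  Hence the functionals 2 M C (b o q), with b in the given
boundary B of X, together with the +- phi_k, attain the norm N everywhere.

Property (star) is handled through the following reformulation: a subset B of
the dual sphere has (star) if and only if, for every unit vector x, some slice
{f in B : f x > 1 - e} with e > 0 is finite.  If all the slices at x are
infinite, then an ultrafilter containing them and all cofinite subsets of B
converges pointwise, by boundedness, to a weak* cluster point of value at least
1 at x.  In this form the property passes to the new boundary: for N z = 1, a
slice of the first family either is empty (when 2 M C |q z| < 1) or comes from a
slice of B at the unit vector 2 M C q z; and |phi_k z| > 3/4 holds for finitely
many k only, because M C |q z| <= 1/2.

Finite slices also give polyhedrality.  The functionals of a finite slice at x
norm every vector near x, so by compactness finitely many members of the
boundary norm a given finite-dimensional subspace, and evaluating them embeds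
that subspace isometrically into l_infty^n. *)

(** * Bounded operators and the open mapping theorem *)

Section BoundedOperators.
Context {R : realType}.

Lemma continuous_linear_bound {V W : normedModType R} (T : {linear V -> W}) :
  continuous T -> exists2 C : R, 0 < C & forall x, `|T x| <= C * `|x|.
Proof.
move=> /linear_bounded_continuous/linear_boundedP Tb.
near +oo_R => C; exists C; first by near: C; exact: nbhs_pinfty_gt.
by near: C.
Unshelve. all: by end_near. Qed.

Lemma bound_continuous_linear {V W : normedModType R} (T : {linear V -> W})
    (C : R) :
  (forall x, `|T x| <= C * `|x|) -> continuous T.
Proof.
move=> TC; apply/linear_bounded_continuous/linear_boundedP; near=> r => x.
by rewrite (le_trans (TC x))// ler_wpM2r//; near: r; exact: nbhs_pinfty_ge.
Unshelve. all: by end_near. Qed.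

(** Some T(B_n) is dense in a ball around a point x, by Baire's theorem; the
differences of elements of T(B_n) then approximate every vector of a ball
around 0, and the rest is homogeneity. *)
Lemma surjective_approx {U V : completeNormedModType R} (T : {linear U -> V}) :
  range T = setT ->
  exists2 M : R, 0 < M & forall (v : V) (e : R), 0 < e ->
    exists2 u, `|u| <= M * `|v| & `|v - T u| < e.
Proof.
move=> Tsurj.
pose A (n : nat) := closure (T @` [set u | `|u| <= n%:R]).
have [n /asboolPn /denseNE[D [[x [Do Dx]] DA]]] :
    exists n, ~~ `[< dense (~` A n) >].
  apply: contrapT => /forallNP allD.
  have /Baire bD : forall i, open (~` A i) /\ dense (~` A i).
    move=> i; split; first by rewrite openC; exact: closed_closure.
    by apply/asboolP; apply: contrapT => /negP /allD.
  have [|v [_ vA]] := bD setT _ openT; first by exists 0.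
  have [u _ uv] : range T v by rewrite Tsurj.
  apply: (vA (Num.truncn `|u|).+1 Logic.I); apply: subset_closure.
  by exists u => //=; rewrite ltW// truncnS_gt.
have /nbhs_ballP[r /= r0 xr] : nbhs x D by exact: open_nbhs_nbhs.
have appr y e : ball x r y -> 0 < e -> exists2 u, `|u| <= n%:R & `|y - T u| < e.
  move=> /xr Dy e0; have Ay : A n y.
    by apply: contrapT => Ay; have : (D `&` ~` A n) y by []; rewrite DA.
  have [_ [[u /= un <-]]] := Ay _ (nbhsx_ballx y _ e0).
  by rewrite -ball_normE; exists u.
have small v e : `|v| < r -> 0 < e ->
    exists2 u, `|u| <= n%:R + n%:R & `|v - T u| < e.
  move=> vr e0; have e2 : 0 < e / 2 by rewrite divr_gt0.
  have [|u un ue] := appr (x + v) _ _ e2.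
    by rewrite -ball_normE /= opprD addNKr normrN.
  have [|w wn we] := appr x _ _ e2; first exact: ballxx.
  exists (u - w); first by rewrite (le_trans (ler_normB _ _))// lerD.
  rewrite linearB/= (_ : v - _ = (x + v - T u) - (x - T w)).
    by rewrite (le_lt_trans (ler_normB _ _))// [ltRHS]splitr ltrD.
  rewrite !opprB (addrC x v) -!addrA; congr (v + _).
  by rewrite [RHS]addrC -!addrA addNr addr0 addrC.
(* The summand 1 only serves to make the constant positive when n = 0. *)
exists ((n%:R + n%:R) * 2 / r + 1) => [|v e e0].
  by rewrite ltr_wpDl// divr_ge0 ?mulr_ge0 ?addr_ge0// ltW.
have [->|v0] := eqVneq v 0.
  by exists 0; [rewrite !normr0 mulr0|rewrite linear0 subr0 normr0].
pose c := r / 2 / `|v|.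
have c0 : 0 < c by rewrite !divr_gt0// normr_gt0.
have [||u un ue] := small (c *: v) (c * e).
- by rewrite normrZ gtr0_norm// divfK ?normr_eq0// gtr_pMr// invf_lt1// ltr1n.
- exact: mulr_gt0.
exists (c^-1 *: u).
  rewrite normrZ gtr0_norm ?invr_gt0// mulrDl mul1r ler_wpDr//.
  rewrite (le_trans (ler_wpM2l _ un)) ?invr_ge0 ?(ltW c0)//.
  rewrite le_eqVlt; apply/orP; left; apply/eqP; rewrite /c; field.
  by rewrite normr_eq0 v0 gt_eqF.
have -> : T (c^-1 *: u) = c^-1 *: T u by rewrite linearZ.
rewrite -(ltr_pM2l c0) -{1}(gtr0_norm c0) -normrZ scalerBr.
by rewrite scalerA mulfV ?gt_eqF// scale1r.
Qed.

(** The error left by an approximate preimage is approximated in turn, with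
precision halved at each step; the sum of the corrections converges absolutely
and is an exact preimage. *)
Theorem open_mapping_bound {U V : completeNormedModType R}
    (T : {linear U -> V}) :
  continuous T -> range T = setT ->
  exists2 M : R, 0 < M & forall v, exists2 u, T u = v & `|u| <= M * `|v|.
Proof.
move=> Tcont Tsurj; have [M M0 TM] := surjective_approx Tsurj.
exists (M * 2) => [|v]; first exact: mulr_gt0.
have [->|v0] := eqVneq v 0.
  by exists 0; [rewrite linear0|rewrite !normr0 mulr0].
have nv0 : 0 < `|v| by rewrite normr_gt0.
pose d n : R := `|v| * 2^-1 ^+ n.
have d0 n : 0 < d n by rewrite mulr_gt0// exprn_gt0.
have /choice[g gP] : forall wn : V * nat, exists u,
    `|u| <= M * `|wn.1| /\ `|wn.1 - T u| < d wn.2.+1.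
  by move=> [w n]; have [u] := TM w _ (d0 n.+1); exists u.
(* w n is the error after n corrections u 0, ..., u n.-1. *)
pose w := fix w n := if n is m.+1 then w m - T (g (w m, m)) else v.
pose u n := g (w n, n).
have wd n : `|w n| <= d n.
  by case: n => [|n]; [rewrite /d expr0 mulr1|exact/ltW/(gP (w n, n)).2].
have Tsum n : T (series u n) = v - w n.
  rewrite /series /=; elim: n => [|n IH].
    by rewrite big_geq// linear0 subrr.
  by rewrite big_nat_recr//= linearD IH/= opprB addrA addrAC.
have sum_le n : \sum_(0 <= k < n) `|u k| <= M * 2 * `|v|.
  apply: (@le_trans _ _ (\sum_(0 <= k < n) M * d k)).
    apply: ler_sum => k _; rewrite (le_trans (gP (w k, k)).1)//.
    by rewrite ler_pM2l//; exact: wd.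
  have -> : \sum_(0 <= k < n) M * d k = M * 2 * `|v| * (1 - 2^-1 ^+ n).
    elim: n => [|n IH]; first by rewrite big_geq// expr0 subrr mulr0.
    by rewrite big_nat_recr//= IH /d exprS; field.
  have Mv : 0 <= M * 2 * `|v| by rewrite !mulr_ge0// ltW.
  by rewrite ler_piMr// lerBlDr lerDl exprn_ge0.
have ucvg : cvgn (series u).
  apply: normed_cvg; apply: nondecreasing_is_cvgn.
    by apply: nondecreasing_series => n _ _; exact: normr_ge0.
  by exists (M * 2 * `|v|) => _ [n _ <-]; exact: sum_le.
exists (limn (series u)).
  have Tlim : T (series u n) @[n --> \oo] --> T (limn (series u)).
    by apply: continuous_cvg; [exact: Tcont|exact: ucvg].
  apply: (cvg_unique _ Tlim) => //; apply/cvgrPdist_lt => e e0.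
  have : d n @[n --> \oo] --> 0.
    by apply: cvg_geometric; rewrite gtr0_norm ?invf_lt1 ?ltr1n.
  move=> /cvgrPdist_lt/(_ _ e0); apply: filterS => n.
  rewrite sub0r normrN gtr0_norm// Tsum opprB addrC subrK.
  exact: le_lt_trans.
apply: (cvgr_to_le (cvg_norm ucvg)); apply: nearW => n.
by rewrite (le_trans _ (sum_le n))// ler_norm_sum.
Qed.

End BoundedOperators.

(** * Injective operators with closed range are bounded below *)

(** The space U normed by |T u|.  It is complete because the range of T is
closed, and the identity from U onto it is bounded, so the open mapping theorem
bounds the inverse.  The two hypotheses are parameters of the type so that the
norm and completeness instances can be attached to it. *)
Definition image_normed {R : realType} {U V : completeNormedModType R}
  (T : {linear U -> V}) (_ : injective T) (_ : closed (range T)) : Type := U.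

Section ImageNorm.
Context {R : realType} {U V : completeNormedModType R} (T : {linear U -> V}).
Context (Tinj : injective T) (Tclosed : closed (range T)).
Local Notation W := (image_normed Tinj Tclosed).

HB.instance Definition _ := GRing.Lmodule.copy W U.

Let normT (u : W) : R := `|T u|.

Let normTD u v : normT (u + v) <= normT u + normT v.
Proof. by rewrite /normT linearD ler_normD. Qed.

Let normTZ a u : normT (a *: u) = `|a| * normT u.
Proof. by rewrite /normT linearZ normrZ. Qed.

Let normT_eq0 u : normT u = 0 -> u = 0.
Proof. by move/normr0_eq0; rewrite -(linear0 T) => /Tinj. Qed.

HB.instance Definition _ := Lmodule_isNormed.Build R W normTD normTZ normT_eq0.

Let complete (F : set_system W) : ProperFilter F -> cauchy F -> cvg F.
Proof.
move=> FF /cauchy_ballP Fc.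
have TFc : cauchy (T @ F).
  apply/cauchy_ballP => e e0; rewrite near_map2; apply: filterS (Fc e e0).
  by move=> -[u v]; rewrite -!ball_normE/= -linearB.
have Tl : T @ F --> lim (T @ F) by exact: cauchy_cvg.
have [u _ uE] : range T (lim (T @ F)).
  by apply: (closed_cvg _ Tclosed) Tl; apply: nearW => v; exists v.
apply/cvg_ex; exists (u : W); apply/cvgrPdist_lt => e e0.
move/cvgrPdist_lt : Tl => /(_ _ e0); apply: filterS => v.
by rewrite -uE -linearB.
Qed.

HB.instance Definition _ := Uniform_isComplete.Build W complete.

End ImageNorm.

Section BoundedBelow.
Context {R : realType}.

Theorem injective_closed_range_bound {U V : completeNormedModType R}
    (T : {linear U -> V}) :
  continuous T -> injective T -> closed (range T) ->
  exists2 C : R, 0 < C & forall u, `|u| <= C * `|T u|.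
Proof.
move=> Tcont Tinj Tclosed; pose W := image_normed Tinj Tclosed.
pose j : {linear U -> W} := idfun.
have [C C0 TC] := continuous_linear_bound Tcont.
have jcont : continuous j by apply: (@bound_continuous_linear _ _ _ _ C).
have jsurj : range j = setT by apply/seteqP; split => // u _; exists u.
have [M M0 jM] := open_mapping_bound jcont jsurj.
by exists M => // u; have [w] := jM (u : W); rewrite /j/= => ->.
Qed.

End BoundedBelow.

(** * The Hahn-Banach theorem *)

Section HahnBanach.
Context {R : realType} {V : lmodType R} (p : V -> R).
Hypothesis pD : forall x y, p (x + y) <= p x + p y.
Hypothesis pZ : forall (a : R) x, 0 < a -> p (a *: x) = a * p x.

(** Partial functionals are represented by their graphs, not assumed to be
functional: a linear graph dominated by p automatically is, since (0, r) in the
graph forces r <= p 0 = 0 and, by linearity, - r <= 0. *)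
Let linear_graph (G : set (V * R)) : Prop :=
  forall (a : R) u v, G u -> G v -> G (a *: u.1 + v.1, a * u.2 + v.2).
Let dominated (G : set (V * R)) : Prop := forall u, G u -> u.2 <= p u.1.

(** The value c at z must satisfy u.2 - p (u.1 - z) <= c <= p (v.1 + z) - v.2
for all u, v in the graph; these bounds are compatible by subadditivity of p, so
the supremum of the lower ones is a valid choice. *)
Lemma dominated_extension_line (G : set (V * R)) (z : V) :
  G (0, 0) -> linear_graph G -> dominated G ->
  exists c : R, dominated [set w | exists2 u, G u &
    exists t : R, w = (u.1 + t *: z, u.2 + t * c)].
Proof.
move=> G0 Glin Gp.
pose S := [set u.2 - p (u.1 - z) | u in G].
have Sub v : G v -> ubound S (p (v.1 + z) - v.2).
  move=> Gv _ [u Gu <-]; rewrite lerBrDr addrAC lerBlDr.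
  have := Gp _ (Glin 1 _ _ Gu Gv); rewrite /= scale1r mul1r => /le_trans; apply.
  by rewrite [leRHS]addrC (le_trans _ (pD _ _))// addrACA addNr addr0.
have S0 : S !=set0 by exists (0 - p (0 - z)), (0, 0).
have GZ (a : R) u : G u -> G (a *: u.1, a * u.2).
  by move=> Gu; have := Glin a _ _ Gu G0; rewrite /= !addr0.
exists (sup S) => _ [u Gu [t ->]] /=.
have [t0|t0|->] := ltgtP t 0; last by rewrite mul0r scale0r !addr0; exact: Gp.
- pose s := - t; have s0 : 0 < s by rewrite oppr_gt0.
  have : s^-1 * u.2 - p (s^-1 *: u.1 - z) <= sup S.
    apply: ub_le_sup; first by exists (p (0 + z) - 0); exact: (Sub _ G0).
    by exists (s^-1 *: u.1, s^-1 * u.2) => //; exact: GZ.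
  rewrite -(ler_pM2l s0) mulrBr mulrA mulfV ?gt_eqF// mul1r -pZ// scalerBr.
  rewrite scalerA mulfV ?gt_eqF// scale1r /s scaleNr opprK mulNr.
  by rewrite lerBlDl lerBrDr.
- have : sup S <= p (t^-1 *: u.1 + z) - t^-1 * u.2.
    by apply: ge_sup => //; exact: (Sub _ (GZ t^-1 u Gu)).
  rewrite -(ler_pM2l t0) mulrBr mulrA mulfV ?gt_eqF// mul1r -pZ// scalerDr.
  by rewrite scalerA mulfV ?gt_eqF// scale1r lerBrDl.
Qed.

Theorem hahn_banach (G0 : set (V * R)) :
  G0 (0, 0) -> linear_graph G0 -> dominated G0 ->
  exists2 f : {linear V -> R^o},
    forall u, G0 u -> f u.1 = u.2 & forall x, f x <= p x.
Proof.
move=> G00 G0lin G0p.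
(* The empty chain has an empty union, which does not contain G0; hence the
   proviso on nonempty G. *)
pose P G := [/\ linear_graph G, dominated G & G !=set0 -> G0 `<=` G].
have [|G [[Glin Gp G0G] Gmax]] := @Zorn_bigcup _ P.
  move=> F FP Ftot; split.
  - move=> a u v [A FA Au] [B FB Bv].
    have [AB|BA] := Ftot _ _ FA FB.
      exists B => //; have [Blin _ _] := FP _ FB.
      by apply: Blin => //; exact: AB.
    exists A => //; have [Alin _ _] := FP _ FA.
    by apply: Alin => //; exact: BA.
  - by move=> u [A FA]; have [_ + _] := FP _ FA; exact.
  - move=> [u [A FA Au]] v G0v; exists A => //.
    by have [_ _] := FP _ FA; apply => //; exists u.
have {}G0G : G0 `<=` G.
  apply: G0G; apply: contrapT => /set0P/negP/negPn/eqP GE.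
  apply: (Gmax G0); last by split => // _; exact: subset_refl.
  by rewrite GE; split; [exact: sub0set|move=> /(_ _ G00)].
have Gzero : G (0, 0) by exact: G0G.
have Gtotal z : exists r, G (z, r).
  have [c cp] := dominated_extension_line z Gzero Glin Gp.
  apply: contrapT => nGz.
  pose H := [set w | exists2 u, G u &
    exists t : R, w = (u.1 + t *: z, u.2 + t * c)].
  apply: (Gmax H); split.
  - move=> [x r] Gxr; exists (x, r) => //.
    by exists 0; rewrite scale0r mul0r !addr0.
  - move=> /(_ (z, c)) Gzc; apply: nGz; exists c.
    apply: Gzc; exists (0, 0) => //.
    by exists 1; rewrite scale1r mul1r !add0r.
  - move=> a _ _ [u Gu [t ->]] [v Gv [s ->]] /=.
    exists (a *: u.1 + v.1, a * u.2 + v.2); first exact: Glin.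
    exists (a * t + s); congr (_, _) => /=.
      by rewrite scalerDr scalerA scalerDl addrACA.
    by rewrite mulrDr mulrA mulrDl addrACA.
  - exact: cp.
  - move=> _ [x r] /G0G Gxr; exists (x, r) => //.
    by exists 0; rewrite scale0r mul0r !addr0.
have p0 : p 0 = 0.
  have := @pZ 2 0 (ltr0n _ 2); rewrite scaler0 mulr_natl mulr2n => /eqP.
  by rewrite -subr_eq subrr eq_sym => /eqP.
have Gle z r s : G (z, r) -> G (z, s) -> s <= r.
  move=> Gr Gs; have := Gp _ (Glin (-1) _ _ Gr Gs).
  by rewrite /= scaleN1r addNr p0 mulN1r addrC subr_le0.
have Gfun z r s : G (z, r) -> G (z, s) -> r = s.
  by move=> Gr Gs; apply/eqP; rewrite eq_le (Gle _ _ _ Gr Gs) (Gle _ _ _ Gs Gr).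
have [f fG] := choice Gtotal.
have flin : linear (f : V -> R^o).
  by move=> a x y; exact: Gfun (fG _) (Glin a _ _ (fG x) (fG y)).
pose F : {linear V -> R^o} := HB.pack (f : V -> R^o)
  (GRing.isLinear.Build _ _ _ _ _ flin).
exists F => [[x r] /G0G Gxr|x]; first exact: Gfun (fG x) Gxr.
exact: Gp (fG x).
Qed.

End HahnBanach.

(** * Property (star) and finite slices *)

Section StarProperty.
Context {R : realType} {V : normedModType R}.
Implicit Types (f g : dual V) (B : set (dual V)).

Lemma dual_sphere_le f x : dual_sphere f -> `|f x| <= `|x|.
Proof.
move=> f1; have [C C0 fC] := continuous_linear_bound (@dual_continuous _ _ f).
have [->|x0] := eqVneq x 0; first by rewrite linear0 !normr0.
have nx : 0 < `|x| by rewrite normr_gt0.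
rewrite -(ler_pM2l (_ : 0 < `|x|^-1)) ?invr_gt0// mulVf ?gt_eqF//.
rewrite -[leRHS]f1 -[X in X * _]gtr0_norm ?invr_gt0// -normrM.
have -> : `|x|^-1 * f x = f (`|x|^-1 *: x) by rewrite linearZ.
apply: ub_le_sup.
  exists C => _ [y /= y1 <-]; rewrite (le_trans (fC y))// ler_piMr//.
  exact: ltW.
by exists (`|x|^-1 *: x) => //=; rewrite normrZ normfV normr_id mulVf// gt_eqF.
Qed.

Lemma dual_sphere_attained f x :
  (forall y, `|f y| <= `|y|) -> x != 0 -> f x = `|x| -> dual_sphere f.
Proof.
move=> fle x0 fx; apply/eqP; rewrite eq_le; apply/andP; split.
  apply: ge_sup => [|_ [y /= y1 <-]]; last exact: le_trans (fle y) y1.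
  by exists `|f 0|, 0; rewrite /= ?normr0.
apply: ub_le_sup.
  by exists 1 => _ [y /= y1 <-]; exact: le_trans (fle y) y1.
exists (`|x|^-1 *: x).
  by rewrite /= normrZ normfV normr_id mulVf ?normr_eq0.
by rewrite linearZ/= fx normrM normfV normr_id mulVf ?normr_eq0.
Qed.

Lemma dual_sphere_neq0 f : dual_sphere f -> exists x : V, x != 0.
Proof.
move=> f1; apply: contrapT => /forallNP V0.
have : dual_norm f <= 0.
  apply: ge_sup => [|_ [x _ <-]]; first by exists `|f 0|, 0; rewrite /= ?normr0.
  by have /negP/negPn/eqP -> := V0 x; rewrite linear0 normr0.
by rewrite [dual_norm f]f1 leNgt ltr01.
Qed.

Lemma weak_star_cvg (F : set_system (dual V)) f : Filter F ->
  (forall x, (fun g : dual V => g x : R^o) @ F --> (f x : R^o)) ->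
  forall U : set (dual V), nbhs (f : weak_star V) U -> F U.
Proof.
move=> FF Ff U [_ [[A Ao <-] Af AU]].
have : {ptws, (fun g : dual V => (g : V -> R^o)) @ F --> (f : V -> R^o)}.
  by apply/pointwise_cvgP => x; exact: Ff.
move=> /(_ A (open_nbhs_nbhs (conj Ao Af))) FA.
by apply: (filterS AU); exact: FA.
Qed.

Lemma weak_star_eval f x (A : set R) :
  nbhs (f x : R) A -> nbhs (f : weak_star V) [set g | A (g x)].
Proof.
move=> fA.
pose emb (g : dual V) : {ptws V -> R^o} := (g : V -> R^o).
have emb_cont : {ptws, emb @ nbhs (f : weak_star V) --> emb f}.
  exact: (@initial_continuous _ _ emb f).
by have /pointwise_cvgP/(_ x)/(_ A fA) := emb_cont.
Qed.

(** For subsets of the dual sphere this is equivalent to property (star); unlike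
the latter it does not mention the weak* topology, and it is what the
renorming and polyhedrality arguments use. *)
Definition finite_slices B := forall x, `|x| = 1 ->
  exists2 e : R, 0 < e & finite_set (B `&` [set f | 1 - e < f x]).

(** Where a cluster point takes the value 1 or more, the slice is the trace on B
of a weak* neighbourhood of it. *)
Lemma finite_slices_star B : finite_slices B -> property_star B.
Proof.
move=> fsB f Bf x x1; rewrite ltNge; apply/negP => fx.
have [e e0] := fsB x x1; apply: Bf.
apply: (@weak_star_eval f x [set r | 1 - e < r]).
by apply: lt_nbhsr; rewrite (lt_le_trans _ fx)// ltrBlDr ltrDl.
Qed.

(** The form of weak* compactness of the dual ball that is needed: at each point
the values lie in a compact segment, and pointwise limits inherit linearity and
the norm bound. *)
Lemma ultrafilter_limit (G : set_system (dual V)) B :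
  UltraFilter G -> G B -> B `<=` @dual_sphere R V ->
  exists f, forall x, (fun g : dual V => g x : R^o) @ G --> (f x : R^o).
Proof.
move=> UG GB Bsph.
have /choice[l lP] : forall x : V, exists r : R,
    `|r| <= `|x| /\ (fun g : dual V => g x : R^o) @ G --> (r : R^o).
  move=> x; pose ev (g : dual V) : R := g x.
  have Gx : G (ev @^-1` `[- `|x|, `|x|]%classic).
    apply: filterS GB => g /Bsph gS /=.
    by rewrite in_itv/= -ler_norml; exact: dual_sphere_le.
  have [r [rx rG]] := @segment_compact R (- `|x|) `|x| (ev @ G) _ Gx.
  exists r; split; first by move: rx; rewrite /= in_itv/= -ler_norml.
  move=> A rA; have [//|GnA] := in_ultra_setVsetC (ev @^-1` A) UG.
  by have [s []] := rG (~` A) A GnA rA.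
have llin : linear (l : V -> R^o).
  move=> a x y.
  have lD : (fun g : dual V => g (a *: x + y) : R^o) @ G -->
      (a *: l x + l y : R^o).
    under eq_fun do rewrite linearP.
    by apply: cvgD; [apply: cvgZr; exact: (lP x).2|exact: (lP y).2].
  by apply: (cvg_unique _ _ lD) => //; exact: (lP _).2.
pose L : {linear V -> R^o} := HB.pack (l : V -> R^o)
  (GRing.isLinear.Build _ _ _ _ _ llin).
have Lcont : continuous L.
  apply: (@bound_continuous_linear _ _ _ _ 1) => x.
  by rewrite mul1r; exact: (lP x).1.
by exists (Dual Lcont) => x; exact: (lP x).2.
Qed.

(** If every slice at x is infinite, the slices and the cofinite sets generate a
proper filter.  Its sets meet B infinitely often, so the limit of a finer
ultrafilter is a weak* cluster point of B, and its value at x is at least 1. *)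
Theorem star_finite_slices B :
  B `<=` @dual_sphere R V -> property_star B -> finite_slices B.
Proof.
move=> Bsph starB x x1; apply: contrapT => /forall2NP nfin.
pose slice (e : R) := B `&` [set f : dual V | 1 - e < f x].
have infslice e : 0 < e -> infinite_set (slice e).
  by move=> e0; have [] := nfin e.
pose F : set_system (dual V) :=
  [set A | exists2 e : R, 0 < e & finite_set (slice e `\` A)].
have FF : ProperFilter F.
  apply: Build_ProperFilter.
    by move=> [e e0]; rewrite setD0; exact: infslice.
  split.
  - by exists 1 => //; rewrite setDT.
  - move=> A A' [e e0 fA] [e' e'0 fA']; exists (Num.min e e').
      by rewrite lt_min e0.
    have : finite_set ((slice e `\` A) `|` (slice e' `\` A')).
      by rewrite finite_setU.
    apply: sub_finite_set => f [[Bf /= fx] nA].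
    have [Af|nAf] := pselect (A f); [right|left]; split => //.
      split => //=; apply: le_lt_trans fx.
        by rewrite lerD2l lerN2 ge_min lexx orbT.
      by move=> A'f; apply: nA.
    by split => //=; apply: le_lt_trans fx; rewrite lerD2l lerN2 ge_min lexx.
  - move=> A A' AA' [e e0 fA]; exists e => //; apply: sub_finite_set fA.
    by move=> f [sf nA]; split => // /AA'.
have [G [UG FG]] := ultraFilterLemma FF.
have FB : F B.
  by exists 1 => //; rewrite (_ : _ `\` _ = set0)// -subset0 => f [[]].
have [f fG] := ultrafilter_limit UG (FG _ FB) Bsph.
have := starB f _ x x1; rewrite ltNge => /(_ _)/negP; apply.
  move=> U fU finU.
  have GU : G U by exact: weak_star_cvg fG _ fU.
  have GnU : G (~` (B `&` U)).
    apply: FG; exists 1 => //; apply: sub_finite_set finU.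
    by move=> g [_ /contrapT].
  have GB := FG _ FB.
  have [g [[Bg Ug] +]] := filter_ex (filterI (filterI GB GU) GnU).
  exact.
apply/ler_addgt0Pr => e e0.
rewrite -lerBlDr; apply: (cvgr_to_ge (fG x)).
have : F (slice e) by exists e => //; rewrite setDv.
by move=> /FG; apply: filterS => g [_ /ltW].
Qed.

End StarProperty.

Section FiniteSlices.
Context {R : realType} {V : normedModType R}.
Implicit Types A B : set (dual V).

Lemma finite_slices_sub A B : A `<=` B -> finite_slices B -> finite_slices A.
Proof.
move=> AB fsB x x1; have [e e0 fB] := fsB x x1; exists e => //.
by apply: sub_finite_set fB => f [Af fx]; split => //; exact: AB.
Qed.

Lemma finite_slicesU A B :
  finite_slices A -> finite_slices B -> finite_slices (A `|` B).
Proof.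
move=> fsA fsB x x1; have [e e0 fA] := fsA x x1; have [d d0 fB] := fsB x x1.
exists (Num.min e d); first by rewrite lt_min e0.
have : finite_set ((A `&` [set f : dual V | 1 - e < f x]) `|`
  (B `&` [set f : dual V | 1 - d < f x])) by rewrite finite_setU.
apply: sub_finite_set => f [[Af|Bf] /= fx]; [left|right]; split => //=.
  by apply: le_lt_trans fx; rewrite lerD2l lerN2 ge_min lexx.
by apply: le_lt_trans fx; rewrite lerD2l lerN2 ge_min lexx orbT.
Qed.

End FiniteSlices.

(** * Polyhedrality *)

Section Polyhedrality.
Context {R : realType}.

(** A generator with a nonzero coefficient in a vanishing combination can be
dropped; this ends at a linearly independent family. *)
Lemma fin_dim_subspace_basis {V : lmodType R} (F : set V) :
  fin_dim_subspace F -> exists (m : nat) (e : 'I_m -> V),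
    F = [set \sum_(j < m) a j *: e j | a in [set: 'I_m -> R]] /\
    forall a : 'I_m -> R, \sum_(j < m) a j *: e j = 0 -> forall j, a j = 0.
Proof.
move=> [m]; elim: m => [|m IH] [e FE].
  by exists 0, e; split => // a _ [].
have [?|/existsNP[a /not_implyP[a_eq0 /existsNP[j0 /eqP aj0]]]] :=
    pselect (forall a : 'I_m.+1 -> R,
      \sum_(j < m.+1) a j *: e j = 0 -> forall j, a j = 0).
  by exists m.+1, e.
apply: IH; exists (e \o lift j0); rewrite FE; apply/seteqP; split => x [b _ <-].
  exists (fun k => b (lift j0 k) - b j0 / a j0 * a (lift j0 k)) => //.
  have -> : \sum_(j < m.+1) b j *: e j =
      \sum_(j < m.+1) (b j - b j0 / a j0 * a j) *: e j.
    under [RHS]eq_bigr do rewrite scalerBl -scalerA.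
    by rewrite sumrB -scaler_sumr a_eq0 scaler0 subr0.
  by rewrite [RHS](bigD1_ord j0)//= divfK// subrr scale0r add0r.
exists (fun j => if unlift j0 j is Some k then b k else 0) => //.
rewrite (bigD1_ord j0)//= unlift_none scale0r add0r.
by apply: eq_bigr => k _; rewrite liftK.
Qed.


(** A functional of the boundary attaining the norm of y is nearly norming at x
when y is close to x, hence belongs to a given slice at x / |x|. *)
Lemma finite_norming_near {V : normedModType R} (B : set (dual V)) (x : V) :
  boundary B -> finite_slices B -> x != 0 ->
  exists S : set (dual V), [/\ finite_set S, S `<=` B &
    exists2 d : R, 0 < d & forall y, `|y - x| < d ->
      exists2 f, S f & f y = `|y|].
Proof.
move=> [Bsph Bnorm] fsB x0; have nx : 0 < `|x| by rewrite normr_gt0.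
have [|e e0 finS] := fsB (`|x|^-1 *: x).
  by rewrite normrZ normfV normr_id mulVf// gt_eqF.
exists (B `&` [set f : dual V | 1 - e < f (`|x|^-1 *: x)]); split => //.
exists (e * `|x| / 2) => [|y yx]; first by rewrite divr_gt0// mulr_gt0.
have [f Bf fy] := Bnorm y; exists f => //; split => //=.
rewrite linearZ/= -(ltr_pM2l nx) mulrA mulfV ?gt_eqF// mul1r.
have fyx : f y - f x <= `|y - x|.
  by rewrite -linearB (le_trans (ler_norm _))// dual_sphere_le//; exact: Bsph.
have xy : `|x| - `|y| <= `|y - x| by rewrite distrC lerB_dist.
rewrite fy in fyx; nra.
Qed.

(** The coordinates with respect to a basis parametrize the subspace by R^m,
whose unit sphere is compact and avoids the kernel of the parametrization.
Finitely many of the neighbourhoods of finite_norming_near cover the image of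
that sphere, and homogeneity extends the conclusion to the whole subspace. *)
Theorem star_boundary_polyhedral (V : normedModType R) :
  has_star_boundary V -> polyhedral V.
Proof.
move=> [B [bdB starB]] F /fin_dim_subspace_basis[m [e [FE efree]]].
have fsB := star_finite_slices bdB.1 starB.
pose E (a : 'rV[R]_m) := \sum_(j < m) a 0 j *: e j.
have Elin : linear E.
  move=> c a b; rewrite /E scaler_sumr -big_split/=; apply: eq_bigr => j _.
  by rewrite !mxE scalerDl scalerA.
pose El : {linear 'rV[R]_m -> V} := HB.pack E
  (GRing.isLinear.Build _ _ _ _ _ Elin).
have Econt : continuous El.
  apply: (@bound_continuous_linear _ _ _ _ (\sum_(j < m) `|e j|)) => a.
  rewrite mulr_suml (le_trans (ler_norm_sum _ _ _))//; apply: ler_sum => j _.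
  rewrite normrZ mulrC ler_wpM2l//.
  rewrite [leRHS]/Num.norm/= mx_normrE; apply/bigmax_geP.
  by right => /=; exists (0, j).
have E_neq0 a : a != 0 -> E a != 0.
  apply: contra_neq => Ea0; apply/rowP => j; rewrite mxE.
  exact: (efree (fun j => a 0 j) Ea0).
pose Sph := [set a : 'rV[R]_m | `|a| = 1].
have Sph_neq0 a : Sph a -> a != 0.
  by move=> a1; rewrite -normr_eq0 a1 oner_eq0.
have cSph : compact Sph.
  apply: bounded_closed_compact.
    by exists 1; split => // M M1 a /= ->; exact: ltW.
  apply: (@preimage_closed _ _ (Num.norm : 'rV[R]_m -> R) [set 1]) => [a _|].
    exact: norm_continuous.
  exact: closed_eq.
have /choice[S SP] : forall a, exists S : set (dual V), Sph a ->
    [/\ finite_set S, S `<=` B &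
      \forall a' \near a, exists2 f, S f & f (E a') = `|E a'|].
  move=> a; have [Sa|nSa] := pselect (Sph a); last by exists set0.
  have [S [finS SB [d d0 dS]]] :=
    finite_norming_near bdB fsB (E_neq0 _ (Sph_neq0 _ Sa)).
  exists S => _; split => //.
  have /cvgrPdist_lt/(_ _ d0) : El a' @[a' --> a] --> El a by exact: Econt.
  by apply: filterS => a' aa'; apply: dS; rewrite distrC.
pose good a := interior [set a' | exists2 f, S a f & f (E a') = `|E a'|].
rewrite compact_cover in cSph.
have [|a Sa|D' D'Sph cov] := cSph _ Sph good.
- by move=> a _; exact: open_interior.
- by exists a => //; have [_ _] := SP a Sa.
pose Sall := \bigcup_(a in [set` D']) S a.
have /finite_seqP[s sE] : finite_set Sall.
  apply: bigcup_finite => [|a /D'Sph]; first exact: finite_fset.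
  by move=> /set_mem/SP[].
have s_sphere f : f \in s -> dual_sphere f.
  move=> fs; have : [set` s] f by [].
  by rewrite -sE => -[a /D'Sph/set_mem/SP[_ SB _] /SB /bdB.1].
have norming a : a != 0 -> exists2 f, f \in s & f (E a) = `|E a|.
  move=> a0; have na : 0 < `|a| by rewrite normr_gt0.
  have [|b D'b /interior_subset[f Sf fE]] := cov (`|a|^-1 *: a).
    by rewrite /Sph/= normrZ normfV normr_id mulVf// gt_eqF.
  exists f; first by have : Sall f; [exists b|rewrite sE].
  have EZ : El (`|a|^-1 *: a) = `|a|^-1 *: El a by rewrite linearZ.
  move: fE; rewrite [E _]EZ linearZ/= normrZ normfV normr_id.
  by apply: mulfI; rewrite invr_eq0 gt_eqF.
exists (size s), (fun x => \row_(j < size s) (tnth (in_tuple s) j : dual V) x).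
split => [c x y _ _|x].
  by apply/rowP => j; rewrite !mxE linearP.
rewrite FE => -[c _ cx].
pose a : 'rV[R]_m := \row_j c j.
have {cx} xE : x = E a by rewrite -cx; apply: eq_bigr => j _; rewrite mxE.
apply/eqP; rewrite eq_le; apply/andP; split.
  rewrite [leLHS]/Num.norm/= mx_normrE; apply: bigmax_le => // -[i j] _.
  by rewrite mxE/= dual_sphere_le//; apply: s_sphere; exact: mem_tnth.
have [a0|a0] := eqVneq a 0.
  by rewrite xE a0 [E 0](linear0 El) normr0.
have [f /(tnthP (in_tuple s))[j fj] fx] := norming a a0.
rewrite [leRHS]/Num.norm/= mx_normrE; apply/bigmax_geP.
right; exists (0, j) => //=.
by rewrite mxE -fj xE fx normr_id.
Qed.

End Polyhedrality.

(** * Coordinate functionals on a twisted sum *)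

Section TwistedSum.
Context {R : realType} {K : Type} {X Z : completeNormedModType R}.
Context (i : {linear c0 R K -> Z}) (q : {linear Z -> X}).
Hypothesis iq_exact : short_exact i q.

Lemma c0_subspace_bound :
  exists2 C : R, 0 < C & forall f, c0_norm f <= C * `|i f|.
Proof.
have [icont qcont ker_i ker_q _] := iq_exact.
apply: (injective_closed_range_bound icont).
  move=> f g fg; apply/eqP; rewrite -subr_eq0; apply/eqP.
  have : (i @^-1` [set 0]) (f - g) by rewrite /= linearB fg subrr.
  by rewrite ker_i.
rewrite -ker_q; apply: preimage_closed => [z _|]; first exact: qcont.
exact/accessible_closed_set1/hausdorff_accessible/norm_hausdorff.
Qed.

(** The k-th coordinate is dominated on i(c_0(K)) by M |z|, with M independent
of k because i is bounded below. *)
Lemma coordinate_extension : exists (phi : K -> {linear Z -> R^o}) (M : R),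
  [/\ 0 < M, forall k z, `|phi k z| <= M * `|z|
    & forall k f, phi k (i f) = f k].
Proof.
have [M M0 iM] := c0_subspace_bound.
have /choice[phi phiP] : forall k, exists phi : {linear Z -> R^o},
    (forall z, `|phi z| <= M * `|z|) /\ forall f, phi (i f) = f k.
  move=> k; pose G := [set (i f, f k) | f in [set: c0 R K]] : set (Z * R).
  have [|||||phi phiG phiM] := @hahn_banach R Z (fun z => M * `|z|) _ _ G.
  - move=> x y; rewrite -mulrDr ler_wpM2l ?ler_normD//; exact: ltW.
  - by move=> a x a0; rewrite normrZ gtr0_norm// mulrCA.
  - by exists 0 => //; rewrite linear0.
  - move=> a _ _ [f _ <-] [g _ <-].
    by exists (a *: f + g) => //=; rewrite linearP.
  - move=> _ [f _ <-] /=; rewrite (le_trans _ (iM f))//.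
    by rewrite (le_trans (ler_norm _))// c0_norm_ub.
  exists phi; split=> [z|f]; last by apply: (phiG (i f, f k)); exists f.
  by rewrite ler_norml phiM andbT lerNl -linearN -(normrN z) phiM.
exists phi, M; split => // [k z|k f]; first exact: (phiP k).1.
exact: (phiP k).2.
Qed.

End TwistedSum.

(** * The renorming *)

Section CoordinateNorm.
Context {R : realType} {K : Type} {X Z : completeNormedModType R}.
Context (i : {linear c0 R K -> Z}) (q : {linear Z -> X}).
Hypothesis iq_exact : short_exact i q.
Context (phi : K -> {linear Z -> R^o}) (M C : R) (k0 : K).
Hypotheses (M_gt0 : 0 < M) (C_gt0 : 0 < C).
Hypothesis phi_le : forall k z, `|phi k z| <= M * `|z|.
Hypothesis phi_i : forall k f, phi k (i f) = f k.
Hypothesis lift : forall x, exists2 z, q z = x & `|z| <= C * `|x|.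

Lemma lift_decomposition z : exists w f,
  [/\ z = w + i f, `|w| <= C * `|q z| & forall k, `|phi k w| <= M * C * `|q z|].
Proof.
have [_ _ _ ker_q _] := iq_exact; have [w qw wC] := lift (q z).
have [f _ fE] : range i (z - w) by rewrite -ker_q /= linearB qw subrr.
exists w, f; split => //; first by rewrite fE addrC subrK.
by move=> k; rewrite (le_trans (phi_le k w))// -mulrA ler_wpM2l// ltW.
Qed.

(** The coordinates of the lifting part of z are at most M C |q z|, and those of
its part in c_0(K) tend to 0. *)
Lemma finite_large_coordinates z e : 0 < e ->
  finite_set [set k | M * C * `|q z| + e <= `|phi k z|].
Proof.
move=> e0; have [w [f [zE _ phiw]]] := lift_decomposition z.
have /vanishingP/(_ _ e0) : c0_fun f \in @vanishing R K by case: (f).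
apply: sub_finite_set => k /= large.
rewrite -(lerD2l (M * C * `|q z|)) (le_trans large)//.
by rewrite {1}zE linearD phi_i (le_trans (ler_normD _ _))// lerD2r.
Qed.

Definition coord_sup z : R := sup [set `|phi k z| | k in [set: K]].

Lemma coord_le_sup k z : `|phi k z| <= coord_sup z.
Proof.
apply: ub_le_sup; last by exists k.
by exists (M * `|z|) => _ [j _ <-]; exact: phi_le.
Qed.

Lemma coord_sup_le z b : (forall k, `|phi k z| <= b) -> coord_sup z <= b.
Proof.
move=> le_b; apply: ge_sup => [|_ [k _ <-]]; last exact: le_b.
by exists `|phi k0 z|, k0.
Qed.

(** Above the midpoint of M C |q z| and the supremum there are only finitely
many coordinates, so the supremum is the largest of them. *)
Lemma coord_sup_attained z : M * C * `|q z| < coord_sup z ->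
  exists k, `|phi k z| = coord_sup z.
Proof.
move=> lt_sup; apply: contrapT => /forallNP not_attained.
pose e := (coord_sup z - M * C * `|q z|) / 2.
have e0 : 0 < e by rewrite divr_gt0// subr_gt0.
have := finite_image (fun k => `|phi k z|) (finite_large_coordinates z e0).
move=> /finite_seqP[s sE].
have : coord_sup z <= \big[Num.max/M * C * `|q z| + e]_(x <- s) x.
  apply: coord_sup_le => k.
  have [large|small] := leP (M * C * `|q z| + e) `|phi k z|.
    have ks : `|phi k z| \in s.
      by have : [set` s] `|phi k z|; [rewrite -sE; exists k|].
    exact: (le_bigmax_seq _ _ _ id ks).
  by rewrite (le_trans (ltW small))// bigmax_ge_id.
apply/negP; rewrite -ltNge big_seq; apply: bigmax_lt => [|x xs].
  by rewrite /e; lra.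
have : [set` s] x by [].
rewrite -sE => -[k _ <-]; rewrite lt_neqAle coord_le_sup andbT.
by apply/eqP; exact: not_attained.
Qed.

Let lam := 2 * M * C.

Let lam_gt0 : 0 < lam.
Proof. by rewrite /lam !mulr_gt0. Qed.

Let N z := Num.max (lam * `|q z|) (coord_sup z).

(** Lower bound: in z = w + i f the vector w is controlled by |q z|, and the
coordinates of f are those of z minus those of w, which are also controlled by
|q z|. *)
Lemma coord_norm_exists : exists N : equiv_norm Z,
  forall z, N z = Num.max (lam * `|q z|) (coord_sup z).
Proof.
have N0 z : 0 <= N z by rewrite le_max mulr_ge0// ltW// lam_gt0.
have qN z : lam * `|q z| <= N z by rewrite le_max lexx.
have phiN k z : `|phi k z| <= N z by rewrite le_max coord_le_sup orbT.
have N_le z b : lam * `|q z| <= b -> (forall k, `|phi k z| <= b) -> N z <= b.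
  by move=> qb phib; rewrite ge_max qb coord_sup_le.
have ND x y : N (x + y) <= N x + N y.
  apply: N_le => [|k]; rewrite linearD.
    rewrite (le_trans (ler_wpM2l (ltW lam_gt0) (ler_normD _ _)))//.
    by rewrite mulrDr lerD.
  by rewrite (le_trans (ler_normD _ _))// lerD.
have NZ_le (a : R) x : N (a *: x) <= `|a| * N x.
  apply: N_le => [|k]; rewrite linearZ normrZ.
    by rewrite mulrCA ler_wpM2l.
  by apply: ler_wpM2l => //; exact: phiN.
have NZ (a : R) x : N (a *: x) = `|a| * N x.
  apply/eqP; rewrite eq_le NZ_le/=.
  have [->|a0] := eqVneq a 0; first by rewrite normr0 mul0r.
  rewrite -ler_pdivlMl ?normr_gt0// -normfV.
  by rewrite -{1}[x]scale1r -(mulVf a0) -scalerA.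
have [icont qcont _ _ _] := iq_exact.
have [Ci Ci0 iC] := continuous_linear_bound icont.
have [Cq Cq0 qC] := continuous_linear_bound qcont.
pose C1 := lam * Cq + M; pose C2 := (2 * M)^-1 + 2 * Ci.
have C1_gt0 : 0 < C1 by rewrite addr_gt0// mulr_gt0// lam_gt0.
have C2_gt0 : 0 < C2 by rewrite addr_gt0// ?invr_gt0 mulr_gt0.
have NC1 z : N z <= C1 * `|z|.
  apply: N_le => [|k]; rewrite mulrDl.
    rewrite ler_wpDr ?mulr_ge0 ?(ltW M_gt0)//.
    by rewrite -mulrA ler_wpM2l// ltW// lam_gt0.
  by rewrite ler_wpDl ?phi_le// !mulr_ge0// ltW// lam_gt0.
have NC2 z : `|z| <= C2 * N z.
  have [w [f [zE wC phiw]]] := lift_decomposition z.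
  have f_le : c0_norm f <= 2 * N z.
    apply: c0_norm_le => [|k]; first by rewrite mulr_ge0.
    have -> : f k = phi k z - phi k w.
      by rewrite {1}zE linearD phi_i addrAC subrr add0r.
    rewrite (le_trans (ler_normB _ _))// mulr_natl mulr2n lerD//.
    rewrite (le_trans (phiw k))// (le_trans _ (qN z))// ler_wpM2r//.
    rewrite /lam -mulrA ler_peMl ?ler1n//.
    by rewrite mulr_ge0// ltW.
  rewrite zE (le_trans (ler_normD _ _))// -zE mulrDl lerD//.
    rewrite (le_trans wC)// ler_pdivlMl ?mulr_gt0//.
    by rewrite mulrA (le_trans _ (qN z)).
  rewrite (le_trans (iC f))// [leRHS]mulrAC [leRHS]mulrC.
  by apply: ler_wpM2l => //; exact: ltW.
have NC z : N z <= (C1 + C2) * `|z| /\ `|z| <= (C1 + C2) * N z.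
  split; first by rewrite (le_trans (NC1 z))// ler_wpM2r// lerDl ltW.
  by rewrite (le_trans (NC2 z))// ler_wpM2r// lerDr ltW.
have N_eq0 z : N z = 0 -> z = 0.
  by move=> Nz; apply/eqP; rewrite -normr_le0 (le_trans (NC2 z))// Nz mulr0.
have C12_gt0 : 0 < C1 + C2 by rewrite addr_gt0.
have N_equiv : exists2 C' : R, 0 < C' &
    forall z, N z <= C' * `|z| /\ `|z| <= C' * N z by exists (C1 + C2).
by exists (EquivNorm ND NZ N_eq0 N_equiv).
Qed.

End CoordinateNorm.

(** * The boundary with property (star) *)

Lemma dual_of_bounded {R : realType} {V : normedModType R} (f : V -> R)
    (C : R) :
  linear (f : V -> R^o) -> (forall x, `|f x| <= C * `|x|) ->
  exists g : dual V, forall x, g x = f x.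
Proof.
move=> flin fC.
pose F : {linear V -> R^o} := HB.pack (f : V -> R^o)
  (GRing.isLinear.Build _ _ _ _ _ flin).
have Fcont : continuous F by exact: (@bound_continuous_linear _ _ _ _ C).
by exists (Dual Fcont).
Qed.

(** The members of the candidate set A norm Z, but their dual norm is only known
to be at most 1; those that attain the norm at a nonzero vector lie on the
sphere, and they suffice because Z is not 0. *)
Theorem twisted_sum_star_boundary (R : realType) (K : Type)
    (X Z : completeNormedModType R) (i : {linear c0 R K -> Z})
    (q : {linear Z -> X}) :
  infinite_set [set: K] ->
  has_star_boundary X -> short_exact i q ->
  exists N : equiv_norm Z, has_star_boundary (renormed N).
Proof.
move=> Kinf [B [[Bsph Bnorm] starB]] iq_exact.
have [k0 _] := infinite_setN0 Kinf.
have [phi [M [M0 phi_le phi_i]]] := coordinate_extension iq_exact.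
have [_ qcont _ _ /(open_mapping_bound qcont)[C C0 lift]] := iq_exact.
have [N NE] := coord_norm_exists iq_exact k0 M0 C0 phi_le phi_i lift.
pose lam := 2 * M * C.
have lam0 : 0 < lam by rewrite /lam !mulr_gt0.
have qN z : lam * `|q z| <= N z by rewrite NE le_max lexx.
have phiN k z : `|phi k z| <= N z.
  by rewrite NE le_max (coord_le_sup phi_le) orbT.
pose W := renormed N.
have /choice[Q QE] : forall b : dual X, exists g : dual W,
    forall z : Z, g z = lam * b (q z).
  move=> b.
  have [Cb Cb0 bC] := continuous_linear_bound (@dual_continuous _ _ b).
  apply: (@dual_of_bounded _ W (fun z : Z => lam * b (q z)) Cb).
    by move=> a x y; rewrite !linearP/= mulrDr mulrCA.
  move=> z; rewrite normrM gtr0_norm//.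
  rewrite (le_trans (ler_wpM2l (ltW lam0) (bC _)))//.
  by rewrite mulrCA ler_pM2l//; exact: qN.
have /choice[P PE] : forall sk : bool * K, exists g : dual W,
    forall z : Z, g z = (-1) ^+ sk.1 * phi sk.2 z.
  move=> [s k].
  apply: (@dual_of_bounded _ W (fun z : Z => (-1) ^+ s * phi k z) 1).
    by move=> a x y; rewrite linearP/= mulrDr mulrCA.
  by move=> z; rewrite normrMsign mul1r; exact: phiN.
pose A := Q @` B `|` range P.
have A_le g z : A g -> `|g z| <= `|z : W|.
  case=> [[b Bb <-]|[[s k] _ <-]]; last by rewrite PE normrMsign; exact: phiN.
  rewrite QE normrM gtr0_norm// (le_trans _ (qN z))// ler_pM2l//.
  by apply: dual_sphere_le; exact: Bsph.
have A_norming (z : W) : exists2 g, A g & g z = `|z|.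
  have [sup_le|lt_sup] := leP (coord_sup phi z) (lam * `|q z|).
    have [b Bb bqz] := Bnorm (q z); exists (Q b); first by left; exists b.
    by rewrite QE bqz; apply: esym; rewrite [LHS]NE max_l.
  have [|k phik] :=
      coord_sup_attained iq_exact k0 M0 phi_le phi_i lift (z := z).
    apply: le_lt_trans lt_sup; rewrite ler_wpM2r// /lam -mulrA.
    by rewrite ler_peMl ?ler1n// mulr_ge0// ltW.
  exists (P (phi k z < 0, k)); first by right; exists (phi k z < 0, k).
  by rewrite PE -normrEsign phik; apply: esym; rewrite [LHS]NE max_r// ltW.
exists N, (A `&` @dual_sphere R W); split.
  split=> [g []//|z].
  have attained (w : W) : w != 0 ->
      exists2 g, (A `&` @dual_sphere R W) g & g w = `|w|.
    move=> w0; have [g Ag gw] := A_norming w.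
    exists g => //; split => //; apply: (dual_sphere_attained _ w0 gw) => y.
    exact: A_le.
  have [->|] := eqVneq z 0; last exact: attained.
  have [b /Bsph/dual_sphere_neq0[x x0] _] := Bnorm 0.
  have [w qw _] := lift x.
  have [|g Ag _] := attained w; last by exists g; rewrite ?linear0 ?normr0.
  by apply: contra_neq x0 => w0; rewrite -qw w0 linear0.
apply/finite_slices_star/(finite_slices_sub (@subIsetl _ A _))/finite_slicesU.
- move=> z Nz; have : `|lam *: q z| <= 1.
    by rewrite normrZ gtr0_norm// -Nz; exact: qN.
  rewrite le_eqVlt => /orP[/eqP x1|x1].
    have [e e0 finB] := star_finite_slices Bsph starB x1.
    exists e => //; apply: sub_finite_set (finite_image Q finB).
    move=> _ [[b Bb <-] /= bz]; exists b => //; split => //=.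
    by move: bz; rewrite QE linearZ.
  exists (1 - `|lam *: q z|); first by rewrite subr_gt0.
  apply: sub_finite_set (finite_set0 _) => _ [[b Bb <-] /=].
  rewrite opprB addrCA subrr addr0 ltNge QE => /negP; apply.
  have -> : lam * b (q z) = b (lam *: q z) by rewrite linearZ.
  by rewrite (le_trans (ler_norm _))// dual_sphere_le//; exact: Bsph.
- move=> z Nz; have e0 : (0 : R) < 4^-1 by rewrite invr_gt0.
  (* As M C |q z| <= 1/2, a slice of width 1/4 only involves coordinates that
     exceed M C |q z| by at least 1/4. *)
  exists 4^-1 => //.
  have := finite_large_coordinates iq_exact M0 phi_le phi_i lift z e0.
  move=> /(finite_setX (@finite_finset _ [set: bool]))/(finite_image P).
  apply: sub_finite_set => _ [[[s k] _ <-] /= skz].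
  exists (s, k) => //; split => //=.
  have := qN z; rewrite (Nz : N z = 1) => qz1.
  have : (-1) ^+ s * phi k z <= `|phi k z|.
    by rewrite -(normrMsign s) ler_norm.
  rewrite PE/= in skz; rewrite /lam in qz1; lra.
Qed.

(** The identity is an isomorphism from Z onto its renorming, which is
polyhedral by its boundary with property (star). *)
Theorem theorem5p5 (R : realType) (K : Type) (X Z : completeNormedModType R)
    (i : {linear c0 R K -> Z}) (q : {linear Z -> X}) :
  infinite_set [set: K] ->
  has_star_boundary X ->
  short_exact i q ->
  (exists N : equiv_norm Z, has_star_boundary (renormed N)) /\
  isomorphically_polyhedral Z.
Proof.
move=> Kinf starX iq_exact.
have [N starN] := twisted_sum_star_boundary Kinf starX iq_exact.
split; first by exists N.
exists (renormed N); split; first exact: star_boundary_polyhedral.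
have [C C0 NC] := enorm_equiv N.
pose T : {linear Z -> renormed N} := idfun.
pose S : {linear renormed N -> Z} := idfun.
exists T, S; split => //.
  by apply: (@bound_continuous_linear _ _ _ _ C) => z; exact: (NC z).1.
by apply: (@bound_continuous_linear _ _ _ _ C) => z; exact: (NC z).2.
Qed.
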